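(* Let $p\ge 1$ be an integer, let $G\in C^1(\mathbb{D})$ be a complex-valued function (not necessarily harmonic), let $K:\mathbb{D}\to\mathbb{C}$ be harmonic, and let $f(z)=|z|^{2(p-1)}G(z)+K(z)$ for $z\in\mathbb{D}$. Suppose that $K$ is univalent and that $K(\mathbb{D})$ is a linearly connected domain with constant $M$. If $$\frac{2(p-1)|G|+\Lambda_G}{|\lambda_K|}<\frac1M \quad\text{on } \mathbb{D},$$ then $f$ is univalent on $\mathbb{D}$. Moreover, if there is a constant $C$ such that $$\frac{2(p-1)|G|+\Lambda_G}{|\lambda_K|}\le C<\frac1M\quad\text{on } \mathbb{D},$$ then $f(\mathbb{D})$ is a linearly connected domain.
   Context: $\mathbb{D}=\{z\in\mathbb{C}:|z|<1\}$. A complex-valued function is in $C^1(\mathbb{D})$ if its real and imaginary parts have continuous first-order partial derivatives in $\mathbb{D}$. A complex-valued function is harmonic if it is twice continuously differentiable and annihilated by the Laplacian $\Delta=4\frac{\partial^2}{\partial z\,\partial\overline z}$. Univalent means injective. For a $C^1$ function $g$, with Wirtinger derivatives $g_z,g_{\overline z}$, set $\lambda_g=|g_z|-|g_{\overline z}|$ and $\Lambda_g=|g_z|+|g_{\overline z}|$. A domain $\Omega\subset\mathbb{C}$ is linearly connected (with constant $M$) if $M<\infty$ is such that any two points $w_1,w_2\in\Omega$ are joined by a path $\gamma\subset\Omega$ of length $\ell(\gamma)\le M|w_1-w_2|$; it is linearly connected if this holds for some $M<\infty$. Inequalities between functions are understood to hold at every point of $\mathbb{D}$, with the quotients well defined (nonzero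 denominators). *)

(* Defs.v *)
From Stdlib Require Import Reals.
From Coquelicot Require Import Coquelicot.

Open Scope R_scope.

Definition unit_disc (z : C) : Prop := Cmod z < 1.

(* Functions on a subset of C are total functions C -> _; only their values on
   the subset matter.  In particular, on an open set the derivatives below do
   not depend on the values taken outside of it. *)

Definition partial_x (u : C -> R) (z : C) : R :=
  Derive (fun x : R => u (x, Im z)) (Re z).

Definition partial_y (u : C -> R) (z : C) : R :=
  Derive (fun y : R => u (Re z, y)) (Im z).

Definition C1_real_on (A : C -> Prop) (u : C -> R) : Prop :=
  forall z : C, A z ->
    ex_derive (fun x : R => u (x, Im z)) (Re z) /\
    ex_derive (fun y : R => u (Re z, y)) (Im z) /\
    continuous (partial_x u) z /\
    continuous (partial_y u) z.

Definition C2_real_on (A : C -> Prop) (u : C -> R) : Prop :=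
  C1_real_on A u /\ C1_real_on A (partial_x u) /\ C1_real_on A (partial_y u).

Definition C1_on (A : C -> Prop) (g : C -> C) : Prop :=
  C1_real_on A (fun z => Re (g z)) /\ C1_real_on A (fun z => Im (g z)).

Definition C2_on (A : C -> Prop) (g : C -> C) : Prop :=
  C2_real_on A (fun z => Re (g z)) /\ C2_real_on A (fun z => Im (g z)).

Definition Cpartial_x (g : C -> C) (z : C) : C :=
  (partial_x (fun w => Re (g w)) z, partial_x (fun w => Im (g w)) z).

Definition Cpartial_y (g : C -> C) (z : C) : C :=
  (partial_y (fun w => Re (g w)) z, partial_y (fun w => Im (g w)) z).

Definition wirtinger (g : C -> C) (z : C) : C :=
  ((Cpartial_x g z - Ci * Cpartial_y g z) / 2)%C.

Definition wirtinger_bar (g : C -> C) (z : C) : C :=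
  ((Cpartial_x g z + Ci * Cpartial_y g z) / 2)%C.

Definition laplacian (g : C -> C) (z : C) : C :=
  (4 * wirtinger (wirtinger_bar g) z)%C.

Definition harmonic_on (A : C -> Prop) (g : C -> C) : Prop :=
  C2_on A g /\ forall z : C, A z -> laplacian g z = 0%C.

Definition lower_dilation (g : C -> C) (z : C) : R :=
  Cmod (wirtinger g z) - Cmod (wirtinger_bar g z).

Definition upper_dilation (g : C -> C) (z : C) : R :=
  Cmod (wirtinger g z) + Cmod (wirtinger_bar g z).

Definition univalent_on (A : C -> Prop) (g : C -> C) : Prop :=
  forall z1 z2 : C, A z1 -> A z2 -> g z1 = g z2 -> z1 = z2.

Definition image (g : C -> C) (A : C -> Prop) (w : C) : Prop :=
  exists z : C, A z /\ g z = w.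

(* Connectedness of an arbitrary subset of C, in its relative topology. *)
Definition connected_set (Omega : C -> Prop) : Prop :=
  forall U V : C -> Prop, open U -> open V ->
    (forall w : C, Omega w -> U w \/ V w) ->
    (exists w : C, Omega w /\ U w) ->
    (exists w : C, Omega w /\ V w) ->
    exists w : C, Omega w /\ U w /\ V w.

Definition is_domain (Omega : C -> Prop) : Prop :=
  (exists w : C, Omega w) /\ open Omega /\ connected_set Omega.

Definition unit_interval (t : R) : Prop := 0 <= t <= 1.

Definition path_in (Omega : C -> Prop) (gamma : R -> C) (w1 w2 : C) : Prop :=
  continuous_on unit_interval gamma /\
  gamma 0 = w1 /\ gamma 1 = w2 /\
  forall t : R, unit_interval t -> Omega (gamma t).

(* The length of gamma on [0,1] is the supremum, possibly p_infty, of the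
   lengths of the inscribed polygons; sum_f_R0 _ n adds the n+1 terms of
   indices 0..n, one for each interval of 0 = t 0 <= ... <= t (S n) = 1. *)
Definition path_length (gamma : R -> C) : Rbar :=
  Lub_Rbar (fun s : R =>
    exists (n : nat) (t : nat -> R),
      t 0%nat = 0 /\ t (S n) = 1 /\
      (forall i : nat, (i <= n)%nat -> t i <= t (S i)) /\
      s = sum_f_R0 (fun i : nat => Cmod (gamma (t (S i)) - gamma (t i))%C) n).

Definition linearly_connected_with (Omega : C -> Prop) (M : R) : Prop :=
  is_domain Omega /\
  forall w1 w2 : C, Omega w1 -> Omega w2 ->
    exists gamma : R -> C,
      path_in Omega gamma w1 w2 /\
      Rbar_le (path_length gamma) (M * Cmod (w1 - w2)%C).

Definition linearly_connected (Omega : C -> Prop) : Prop :=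
  exists M : R, linearly_connected_with Omega M.

(* Main.v *)
(* Write g = |z|^(2(p-1)) G and h = g o K^{-1} on Omega = K(D), so that
   f o K^{-1} = id + h.  Both g and K are controlled to first order by their
   Wirtinger derivatives, and |z|^(2(p-1)) is 2(p-1)-Lipschitz and at most 1 on D,
   so near every point h is Lipschitz with a constant below 1/M.  Chaining these
   local bounds along a path of length at most M |w1 - w2| gives
   |h w1 - h w2| < |w1 - w2|, hence injectivity.  With a uniform bound c < 1/M,
   id + h multiplies path lengths by at most 1 + c and distances by at least
   1 - c M, so Omega's linear connectivity passes to f(D) with constant
   (1 + c) M / (1 - c M). *)

Require Import Defs.
From Stdlib Require Import Reals Lra Lia Classical IndefiniteDescription
  FunctionalExtensionality PropExtensionality.
From Coquelicot Require Import Coquelicot.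

Open Scope R_scope.

(** * Modulus estimates and neighbourhoods in the plane *)

Lemma Cmod_sub_sym (z w : C) : Cmod (z - w)%C = Cmod (w - z)%C.
Proof. rewrite <- Cmod_opp. f_equal. ring. Qed.

Lemma Cmod_sub_triangle (u v w : C) :
  Cmod (u - w)%C <= Cmod (u - v)%C + Cmod (v - w)%C.
Proof.
  replace (u - w)%C with ((u - v) + (v - w))%C by ring. apply Cmod_triangle.
Qed.

Lemma Cmod_le_abs_sum (z : C) : Cmod z <= Rabs (Re z) + Rabs (Im z).
Proof.
  destruct z as [x y]; simpl.
  replace ((x, y) : C) with (RtoC x + Ci * RtoC y)%C
    by (apply injective_projections; simpl; ring).
  eapply Rle_trans; [apply Cmod_triangle|].
  rewrite Cmod_mult, Cmod_Ci, !Cmod_R. lra.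
Qed.

Lemma im_le_Cmod (z : C) : Rabs (Im z) <= Cmod z.
Proof. eapply Rle_trans; [apply Rmax_r | apply Rmax_Cmod]. Qed.

(** The uniform structure on [C] is that of a product, whose balls are squares; squares and round
    discs fit inside one another up to a factor [sqrt 2]. Later arguments can then work with [Cmod]
    alone. *)
Lemma locally_C_iff (z : C) (P : C -> Prop) :
  locally z P <->
  exists d : R, 0 < d /\ forall w : C, Cmod (w - z)%C < d -> P w.
Proof.
  split.
  - intros [d Hd]. exists d. split; [apply cond_pos|].
    intros w Hw. apply Hd. now apply C_NormedModule_mixin_compat1.
  - intros [d [Hd H]].
    assert (Hs : 0 < sqrt 2) by (apply sqrt_lt_R0; lra).
    assert (Hd' : 0 < d / sqrt 2) by (apply Rdiv_lt_0_compat; lra).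
    exists (mkposreal _ Hd'). intros w Hw. apply H.
    apply C_NormedModule_mixin_compat2 in Hw. simpl in Hw.
    change (Cmod (minus w z) < d).
    replace d with (sqrt 2 * (d / sqrt 2)) by (field; lra). exact Hw.
Qed.

Lemma unit_disc_open : open unit_disc.
Proof.
  intros z Hz. apply locally_C_iff. exists (1 - Cmod z).
  unfold unit_disc in *. split; [lra|]. intros w Hw.
  replace w with ((w - z) + z)%C by ring.
  eapply Rle_lt_trans; [apply Cmod_triangle | lra].
Qed.

(** * Strict differentiability of real-valued C^1 functions *)

Lemma mean_value_between (f df : R -> R) (a b : R) :
  (forall x, Rmin a b <= x <= Rmax a b -> is_derive f x (df x)) ->
  exists c, Rmin a b <= c <= Rmax a b /\ f b - f a = df c * (b - a).
Proof.
  intros H. apply MVT_gen; intros x Hx.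
  - apply H; lra.
  - apply continuity_pt_filterlim. apply (ex_derive_continuous f).
    eexists. apply H. exact Hx.
Qed.

Lemma between_near (a b m e x : R) :
  Rabs (a - m) < e -> Rabs (b - m) < e -> Rmin a b <= x <= Rmax a b ->
  Rabs (x - m) < e.
Proof.
  intros Ha%Rabs_def2 Hb%Rabs_def2. unfold Rmin, Rmax.
  destruct (Rle_dec a b); intros; apply Rabs_def1; lra.
Qed.

(** Go from [z2] to [z1] along a vertical and a horizontal leg and apply the mean value theorem on
    each; by continuity the partial derivatives met there differ from those at [z0] by at most
    [eps / 2]. Both points vary, which a derivative at [z0] alone would not allow; this is what
    yields Lipschitz bounds between arbitrary nearby points. *)
Lemma C1_real_strictly_differentiable (A : C -> Prop) (u : C -> R) (z0 : C) (eps : R) :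
  open A -> C1_real_on A u -> A z0 -> 0 < eps ->
  exists d : R, 0 < d /\ forall z1 z2 : C,
    Cmod (z1 - z0)%C < d -> Cmod (z2 - z0)%C < d ->
    Rabs (u z1 - u z2 - (partial_x u z0 * Re (z1 - z2)%C
                         + partial_y u z0 * Im (z1 - z2)%C))
    <= eps * Cmod (z1 - z2)%C.
Proof.
  intros HA Hu Hz Heps.
  assert (He : 0 < eps / 2) by lra.
  destruct (Hu z0 Hz) as (_ & _ & Cx & Cy).
  assert (Cx' := proj1 (filterlim_locally _ _) Cx (mkposreal _ He)).
  assert (Cy' := proj1 (filterlim_locally _ _) Cy (mkposreal _ He)).
  destruct (filter_and _ _ (HA z0 Hz) (filter_and _ _ Cx' Cy')) as [d Hd].
  (* The neighbourhood is a square, so it contains the corner [(x2, y1)] and with it both legs. *)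
  assert (Hbox : forall x y : R, Rabs (x - Re z0) < d -> Rabs (y - Im z0) < d ->
            A (x, y) /\ Rabs (partial_x u (x, y) - partial_x u z0) < eps / 2 /\
            Rabs (partial_y u (x, y) - partial_y u z0) < eps / 2).
  { intros x y Hx Hy. apply (Hd (x, y)). split; assumption. }
  exists d. split; [apply cond_pos|]. intros [x1 y1] [x2 y2] H1 H2.
  assert (X1 := Rle_lt_trans _ _ _ (re_le_Cmod _) H1).
  assert (X2 := Rle_lt_trans _ _ _ (re_le_Cmod _) H2).
  assert (Y1 := Rle_lt_trans _ _ _ (im_le_Cmod _) H1).
  assert (Y2 := Rle_lt_trans _ _ _ (im_le_Cmod _) H2).
  simpl in X1, X2, Y1, Y2.
  change (Rabs (x1 - Re z0) < d) in X1. change (Rabs (x2 - Re z0) < d) in X2.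
  change (Rabs (y1 - Im z0) < d) in Y1. change (Rabs (y2 - Im z0) < d) in Y2.
  destruct (mean_value_between (fun x => u (x, y1)) (fun x => partial_x u (x, y1)) x2 x1)
    as (xi & Hxi & Exi).
  { intros x Hx.
    destruct (Hbox x y1) as (HAx & _); [now apply (between_near x2 x1) | assumption |].
    apply Derive_correct. exact (proj1 (Hu _ HAx)). }
  destruct (mean_value_between (fun y => u (x2, y)) (fun y => partial_y u (x2, y)) y2 y1)
    as (eta & Heta & Eeta).
  { intros y Hy.
    destruct (Hbox x2 y) as (HAy & _); [assumption | now apply (between_near y2 y1) |].
    apply Derive_correct. exact (proj1 (proj2 (Hu _ HAy))). }
  destruct (Hbox xi y1) as (_ & Bx & _); [now apply (between_near x2 x1) | assumption |].
  destruct (Hbox x2 eta) as (_ & _ & By); [assumption | now apply (between_near y2 y1) |].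
  assert (Vx := re_le_Cmod ((x1, y1) - (x2, y2))%C).
  assert (Vy := im_le_Cmod ((x1, y1) - (x2, y2))%C).
  set (v := ((x1, y1) - (x2, y2))%C) in *.
  assert (Er : Re v = x1 - x2) by reflexivity.
  assert (Ei : Im v = y1 - y2) by reflexivity.
  rewrite Er, Ei in *.
  replace (u (x1, y1) - u (x2, y2) - _)
    with ((partial_x u (xi, y1) - partial_x u z0) * (x1 - x2)
          + (partial_y u (x2, eta) - partial_y u z0) * (y1 - y2)) by lra.
  eapply Rle_trans; [apply Rabs_triang|]. rewrite !Rabs_mult.
  assert (P1 := Rabs_pos (x1 - x2)). assert (P2 := Rabs_pos (y1 - y2)).
  assert (Rabs (partial_x u (xi, y1) - partial_x u z0) * Rabs (x1 - x2)
          <= eps / 2 * Cmod v) by (apply Rmult_le_compat; auto using Rabs_pos; lra).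
  assert (Rabs (partial_y u (x2, eta) - partial_y u z0) * Rabs (y1 - y2)
          <= eps / 2 * Cmod v) by (apply Rmult_le_compat; auto using Rabs_pos; lra).
  lra.
Qed.

(** * The real differential in Wirtinger form, and local openness *)

(** This is the real-linear differential of [g] at [z] applied to [v], when [g] is C^1 near [z]. *)
Definition wirtinger_differential (g : C -> C) (z v : C) : C :=
  (wirtinger g z * v + wirtinger_bar g z * Cconj v)%C.

Lemma C1_strictly_differentiable (A : C -> Prop) (g : C -> C) (z0 : C) (eps : R) :
  open A -> C1_on A g -> A z0 -> 0 < eps ->
  exists d : R, 0 < d /\ forall z1 z2 : C,
    Cmod (z1 - z0)%C < d -> Cmod (z2 - z0)%C < d ->
    Cmod (g z1 - g z2 - wirtinger_differential g z0 (z1 - z2))%C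
    <= eps * Cmod (z1 - z2)%C.
Proof.
  intros HA [Hr Hi] Hz Heps.
  destruct (C1_real_strictly_differentiable A _ z0 (eps / 2) HA Hr Hz) as (d1 & P1 & H1); [lra|].
  destruct (C1_real_strictly_differentiable A _ z0 (eps / 2) HA Hi Hz) as (d2 & P2 & H2); [lra|].
  exists (Rmin d1 d2). split; [now apply Rmin_glb_lt|].
  intros z1 z2 B1 B2.
  specialize (H1 z1 z2 (Rlt_le_trans _ _ _ B1 (Rmin_l _ _)) (Rlt_le_trans _ _ _ B2 (Rmin_l _ _))).
  specialize (H2 z1 z2 (Rlt_le_trans _ _ _ B1 (Rmin_r _ _)) (Rlt_le_trans _ _ _ B2 (Rmin_r _ _))).
  set (v := (z1 - z2)%C) in *.
  assert (E : wirtinger_differential g z0 v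
              = (Cpartial_x g z0 * RtoC (Re v) + Cpartial_y g z0 * RtoC (Im v))%C).
  { unfold wirtinger_differential, wirtinger, wirtinger_bar.
    generalize (Cpartial_x g z0) (Cpartial_y g z0). intros a b.
    destruct a, b, v. apply injective_projections; simpl; field. }
  rewrite E. eapply Rle_trans; [apply Cmod_le_abs_sum|].
  eapply Rle_trans; [apply Rplus_le_compat; [eapply Rle_trans; [|exact H1] | eapply Rle_trans; [|exact H2]]|lra].
  - right. f_equal. unfold Cpartial_x, Cpartial_y, Re, Im. simpl. ring.
  - right. f_equal. unfold Cpartial_x, Cpartial_y, Re, Im. simpl. ring.
Qed.

Lemma wirtinger_differential_upper (g : C -> C) (z v : C) :
  Cmod (wirtinger_differential g z v) <= upper_dilation g z * Cmod v.
Proof.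
  eapply Rle_trans; [apply Cmod_triangle|].
  rewrite !Cmod_mult, Cmod_conj. unfold upper_dilation. lra.
Qed.

(** The reverse triangle inequality for the two terms, used in both directions: the absolute value
    treats sense-preserving and sense-reversing maps at once. *)
Lemma wirtinger_differential_lower (g : C -> C) (z v : C) :
  Rabs (lower_dilation g z) * Cmod v <= Cmod (wirtinger_differential g z v).
Proof.
  unfold wirtinger_differential, lower_dilation.
  set (a := (wirtinger g z * v)%C). set (b := (wirtinger_bar g z * Cconj v)%C).
  rewrite <- (Rabs_pos_eq (Cmod v)) by apply Cmod_ge_0.
  rewrite <- Rabs_mult.
  replace ((Cmod (wirtinger g z) - Cmod (wirtinger_bar g z)) * Cmod v)
    with (Cmod a - Cmod b)
    by (unfold a, b; rewrite !Cmod_mult, Cmod_conj; ring).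
  assert (Ta := Cmod_triangle (a + b) (- b)). rewrite Cmod_opp in Ta.
  replace (a + b + - b)%C with a in Ta by ring.
  assert (Tb := Cmod_triangle (a + b) (- a)). rewrite Cmod_opp in Tb.
  replace (a + b + - a)%C with b in Tb by ring.
  apply Rabs_le. lra.
Qed.

(** The equation [a v + b conj(v) = w] and its conjugate form a linear system in [v] and [conj(v)]
    with determinant [|a|^2 - |b|^2], the Jacobian; Cramer's rule gives the witness. *)
Lemma wirtinger_differential_surjective (g : C -> C) (z w : C) :
  lower_dilation g z <> 0 -> exists v, wirtinger_differential g z v = w.
Proof.
  intros H. unfold lower_dilation in H. unfold wirtinger_differential.
  set (a := wirtinger g z) in *. set (b := wirtinger_bar g z) in *.
  assert (HJ : Cmod a ^ 2 - Cmod b ^ 2 <> 0).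
  { assert (0 <= Cmod a) by apply Cmod_ge_0. assert (0 <= Cmod b) by apply Cmod_ge_0.
    intros E. assert ((Cmod a - Cmod b) * (Cmod a + Cmod b) = 0) as [|]%Rmult_integral by lra; lra. }
  rewrite !Cmod2_alt in HJ.
  exists ((Cconj a * w - b * Cconj w) / RtoC (Re a ^ 2 + Im a ^ 2 - (Re b ^ 2 + Im b ^ 2)))%C.
  destruct a as [a1 a2], b as [b1 b2], w as [w1 w2]. simpl in HJ |- *.
  apply injective_projections; simpl; field; lra.
Qed.

(* Graves' iteration: correct [u] by a preimage, under the approximate
   differential [D], of the residue [w - F u]; each step multiplies the residue
   by at most [eps / lam]. *)
Lemma approximately_linear_open (F D : C -> C) (z0 : C) (r lam eps N : R) :
  0 <= eps < lam ->
  (forall w, exists v, D v = w) ->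
  (forall v, lam * Cmod v <= Cmod (D v) <= N * Cmod v) ->
  (forall u1 u2, Cmod (u1 - z0)%C < r -> Cmod (u2 - z0)%C < r ->
     Cmod (F u1 - F u2 - D (u1 - u2))%C <= eps * Cmod (u1 - u2)%C) ->
  forall w, Cmod (w - F z0)%C < (lam - eps) * r ->
  exists u, Cmod (u - z0)%C < r /\ F u = w.
Proof.
  intros Heps Hsurj HD HF w Hw.
  destruct (functional_choice _ Hsurj) as [Dinv HS]. clear Hsurj.
  assert (HSle : forall y, lam * Cmod (Dinv y) <= Cmod y).
  { intros y. rewrite <- (HS y) at 2. apply HD. }
  set (e := Cmod (w - F z0)%C) in *.
  assert (He : 0 <= e) by apply Cmod_ge_0.
  set (q := eps / lam).
  assert (Hq : 0 <= q < 1).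
  { unfold q. split; [apply Rdiv_le_0_compat; lra|].
    apply (Rmult_lt_reg_r lam); [lra|]. field_simplify; lra. }
  assert (Eq : eps = q * lam) by (unfold q; field; lra).
  assert (Hqn : forall n, 0 <= q ^ n) by (intros; apply pow_le; lra).
  pose (step := fun u : C => (u + Dinv (w - F u))%C).
  pose (U := fun n => Nat.iter n step z0).
  assert (US : forall n, U (S n) = (U n + Dinv (w - F (U n)))%C) by reflexivity.
  (* The sum of the geometric series of step lengths [(e / lam) q^n], hence a bound on the total
     distance travelled from [z0]. *)
  set (rho := e / (lam - eps)).
  assert (Hrho : rho < r).
  { unfold rho. apply (Rmult_lt_reg_r (lam - eps)); [lra|]. field_simplify; lra. }
  assert (Hrho' : rho = e / lam / (1 - q)) by (unfold rho, q; field; lra).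
  assert (Hel : 0 <= e / lam) by (apply Rdiv_le_0_compat; lra).
  assert (Hrho0 : 0 <= rho) by (unfold rho; apply Rdiv_le_0_compat; lra).
  (* The two bounds need each other: the residue fixes the length of the next step, and the distance
     bound keeps the next iterate inside the ball where [HF] controls its residue. *)
  assert (HU : forall n, Cmod (w - F (U n))%C <= q ^ n * e /\
                         Cmod (U n - z0)%C <= rho * (1 - q ^ n)).
  { induction n as [|n [IHr IHd]].
    - simpl. replace (z0 - z0)%C with (RtoC 0) by ring. rewrite Cmod_0.
      fold e. lra.
    - assert (Hs : Cmod (Dinv (w - F (U n)))%C <= q ^ n * (e / lam)).
      { apply (Rmult_le_reg_l lam); [lra|].
        eapply Rle_trans; [apply HSle|]. field_simplify; lra. }
      assert (Hd : Cmod (U (S n) - z0)%C <= rho * (1 - q ^ S n)).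
      { rewrite US.
        replace (U n + Dinv (w - F (U n)) - z0)%C
          with ((U n - z0) + Dinv (w - F (U n)))%C by ring.
        eapply Rle_trans; [apply Cmod_triangle|].
        replace (rho * (1 - q ^ S n))
          with (rho * (1 - q ^ n) + q ^ n * (rho * (1 - q))) by (simpl; ring).
        replace (rho * (1 - q)) with (e / lam) by (rewrite Hrho'; field; lra).
        lra. }
      split; [|exact Hd].
      assert (rho * (1 - q ^ n) <= rho * 1) by (apply Rmult_le_compat_l; [lra|]; specialize (Hqn n); lra).
      assert (rho * (1 - q ^ S n) <= rho * 1)
        by (apply Rmult_le_compat_l; [lra|]; specialize (Hqn (S n)); lra).
      assert (B := HF (U (S n)) (U n)).
      replace (U (S n) - U n)%C with (Dinv (w - F (U n)))%C in B
        by (rewrite US; ring).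
      rewrite HS in B.
      rewrite <- Cmod_opp.
      replace (- (w - F (U (S n))))%C
        with (F (U (S n)) - F (U n) - (w - F (U n)))%C by ring.
      eapply Rle_trans; [apply B; lra|].
      rewrite Eq. replace (q ^ S n * e) with (q * (lam * (q ^ n * (e / lam))))
        by (simpl; field; lra).
      rewrite Rmult_assoc. apply Rmult_le_compat_l; [lra|].
      apply Rmult_le_compat_l; lra. }
  assert (Hser : ex_series (fun n => Dinv (w - F (U n))%C : C_CompleteNormedModule)).
  { apply (ex_series_le (V := C_CompleteNormedModule) _ (fun n => (e / lam) * q ^ n)).
    - intros n. change (Cmod (Dinv (w - F (U n))%C) <= e / lam * q ^ n).
      apply (Rmult_le_reg_l lam); [lra|].
      eapply Rle_trans; [apply HSle|]. eapply Rle_trans; [apply HU|]. right; field; lra.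
    - apply (ex_series_scal (e / lam) (fun n => q ^ n)).
      exists (/ (1 - q)). apply is_series_geom. rewrite Rabs_pos_eq; lra. }
  destruct Hser as [l Hl].
  (* The corrections telescope; [sum_n] includes the term of index [n], hence [U (S n)]. *)
  assert (Hsum : forall n, sum_n (fun n => Dinv (w - F (U n))%C : C_CompleteNormedModule) n
                 = (U (S n) - z0)%C).
  { induction n as [|n IHn].
    - rewrite sum_O, US. change (U 0%nat) with z0.
      change (Dinv (w - F z0)%C = (z0 + Dinv (w - F z0) - z0)%C). ring.
    - rewrite sum_Sn, IHn, (US (S n)).
      change ((U (S n) - z0) + Dinv (w - F (U (S n)))
              = U (S n) + Dinv (w - F (U (S n))) - z0)%C. ring. }
  set (u := (z0 + l)%C).
  assert (Hlim : forall d, 0 < d -> exists n0, forall n, (n0 <= n)%nat -> Cmod (U (S n) - u)%C < d).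
  { intros d Hd.
    assert (Hloc : locally l (fun x : C => Cmod (x - l)%C < d)).
    { apply locally_C_iff. now exists d. }
    destruct (Hl _ Hloc) as [n0 Hn0]. exists n0. intros n Hn.
    specialize (Hn0 n Hn). rewrite Hsum in Hn0.
    unfold u. replace (U (S n) - (z0 + l))%C with (U (S n) - z0 - l)%C by ring.
    exact Hn0. }
  assert (Hu : Cmod (u - z0)%C <= rho).
  { apply le_epsilon. intros d Hd. destruct (Hlim d Hd) as [n Hn].
    specialize (Hn n (le_n _)). rewrite Cmod_sub_sym in Hn.
    assert (T := Cmod_sub_triangle u (U (S n)) z0).
    destruct (HU (S n)) as [_ B].
    assert (rho * (1 - q ^ S n) <= rho * 1)
      by (apply Rmult_le_compat_l; [lra|]; specialize (Hqn (S n)); lra).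
    lra. }
  exists u. split; [lra|].
  assert (Z : Cmod (F u - w)%C = 0).
  { apply Rle_antisym; [|apply Cmod_ge_0]. apply le_epsilon. intros d Hd.
    assert (HN : 0 <= N).
    { destruct (HD 1%C). rewrite Cmod_1 in *. lra. }
    (* Half of [d] pays for passing from [u] to an iterate, [F] being Lipschitz with constant
       [N + eps] on the ball; the other half pays for the residue. The [+ 1] keeps the denominator
       positive. *)
    set (d' := d / (2 * (N + eps + 1))).
    assert (Hd' : 0 < d') by (unfold d'; apply Rdiv_lt_0_compat; lra).
    assert (Ed' : (N + eps + 1) * d' = d / 2) by (unfold d'; field; lra).
    destruct (Hlim d' Hd') as [n1 Hn1].
    assert (Hg : is_lim_seq (fun n => q ^ n * e) 0).
    { replace (Finite 0) with (Rbar_mult 0 e) by (simpl; f_equal; ring).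
      apply is_lim_seq_scal_r. apply is_lim_seq_geom. rewrite Rabs_pos_eq; lra. }
    apply is_lim_seq_spec in Hg.
    assert (Hd2 : 0 < d / 2) by lra.
    destruct (Hg (mkposreal _ Hd2)) as [n2 Hn2].
    set (n := max n1 n2).
    specialize (Hn1 n (Nat.le_max_l _ _)).
    specialize (Hn2 (S n) (Nat.le_trans _ _ _ (Nat.le_max_r n1 n2) (Nat.le_succ_diag_r _))).
    cbv beta in Hn2. simpl pos in Hn2. rewrite Rminus_0_r in Hn2.
    apply Rabs_def2 in Hn2.
    destruct (HU (S n)) as [B1 B2].
    assert (rho * (1 - q ^ S n) <= rho * 1)
      by (apply Rmult_le_compat_l; [lra|]; specialize (Hqn (S n)); lra).
    assert (B3 : Cmod (F u - F (U (S n)))%C <= (N + eps) * Cmod (u - U (S n))%C).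
    { replace (F u - F (U (S n)))%C
        with ((F u - F (U (S n)) - D (u - U (S n))) + D (u - U (S n)))%C
        by ring.
      eapply Rle_trans; [apply Cmod_triangle|].
      assert (B := HF u (U (S n))). destruct (HD (u - U (S n))%C).
      assert (B' := B ltac:(lra) ltac:(lra)). lra. }
    rewrite Cmod_sub_sym in Hn1.
    assert ((N + eps) * Cmod (u - U (S n))%C <= (N + eps) * d')
      by (apply Rmult_le_compat_l; lra).
    assert (T := Cmod_sub_triangle (F u) (F (U (S n))) w).
    rewrite (Cmod_sub_sym (F (U (S n))) w) in T. lra. }
  apply Cmod_eq_0 in Z.
  replace (F u) with ((F u - w) + w)%C by ring. rewrite Z. ring.
Qed.

(** Strict differentiability with error [lam / 2] puts [K] within reach of the iteration above, its
    differential being bounded below by [lam]. Combined with injectivity, this will give continuity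
    of the inverse of [K]. *)
Lemma C1_locally_open (A : C -> Prop) (K : C -> C) (z0 : C) (r : R) :
  open A -> C1_on A K -> A z0 -> lower_dilation K z0 <> 0 -> 0 < r ->
  exists s, 0 < s /\
    forall w, Cmod (w - K z0)%C < s -> exists u, Cmod (u - z0)%C < r /\ K u = w.
Proof.
  intros HA HK Hz Hlam Hr.
  assert (Hl : 0 < Rabs (lower_dilation K z0)) by now apply Rabs_pos_lt.
  set (lam := Rabs (lower_dilation K z0)) in *.
  destruct (C1_strictly_differentiable A K z0 (lam / 2) HA HK Hz) as (d & Hd & H); [lra|].
  set (rho := Rmin d r).
  assert (0 < rho) by now apply Rmin_glb_lt.
  exists ((lam - lam / 2) * rho). split; [apply Rmult_lt_0_compat; lra|].
  intros w Hw.
  destruct (approximately_linear_open K (wirtinger_differential K z0) z0 rho lam (lam / 2)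
              (upper_dilation K z0)) with (w := w) as (u & Hu & E); auto.
  - lra.
  - intros y. now apply wirtinger_differential_surjective.
  - intros v. split; [apply wirtinger_differential_lower | apply wirtinger_differential_upper].
  - intros u1 u2 H1 H2. unfold rho in *.
    apply H; eapply Rlt_le_trans; eauto; apply Rmin_l.
  - exists u. split; [|exact E]. eapply Rlt_le_trans; [exact Hu | apply Rmin_r].
Qed.

(** * Comparison of increments of the weighted [G] with those of [K] *)

Lemma pow_unit_lipschitz (n : nat) (a b : R) :
  0 <= a <= 1 -> 0 <= b <= 1 -> Rabs (a ^ n - b ^ n) <= INR n * Rabs (a - b).
Proof.
  intros Ha Hb. induction n as [|n IHn].
  - simpl. rewrite Rminus_diag, Rabs_R0. lra.
  - rewrite S_INR.
    replace (a ^ S n - b ^ S n) with (a * (a ^ n - b ^ n) + b ^ n * (a - b)) by (simpl; ring).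
    eapply Rle_trans; [apply Rabs_triang|]. rewrite !Rabs_mult.
    assert (Rabs a <= 1) by (apply Rabs_le; lra).
    assert (0 <= b ^ n <= 1).
    { split; [apply pow_le; lra|]. rewrite <- (pow1 n). apply pow_incr; lra. }
    rewrite (Rabs_pos_eq (b ^ n)) by lra.
    assert (P1 := Rabs_pos (a ^ n - b ^ n)). assert (P2 := Rabs_pos (a - b)).
    assert (Rabs a * Rabs (a ^ n - b ^ n) <= 1 * Rabs (a ^ n - b ^ n))
      by (apply Rmult_le_compat_r; lra).
    assert (b ^ n * Rabs (a - b) <= 1 * Rabs (a - b)) by (apply Rmult_le_compat_r; lra).
    lra.
Qed.

Lemma Cmod_reverse_triangle (z w : C) : Rabs (Cmod z - Cmod w) <= Cmod (z - w)%C.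
Proof.
  assert (T1 := Cmod_triangle (z - w) w). assert (T2 := Cmod_triangle (w - z) z).
  rewrite (Cmod_sub_sym w z) in T2.
  replace (z - w + w)%C with z in T1 by ring. replace (w - z + z)%C with w in T2 by ring.
  apply Rabs_le. lra.
Qed.

(* No derivative of [|z|^n] is taken: on the disc it is [n]-Lipschitz. *)
Lemma radial_weight_locally_lipschitz (n : nat) (G K : C -> C) (z0 : C) (L : R) :
  C1_on unit_disc G -> C1_on unit_disc K -> unit_disc z0 ->
  INR n * Cmod (G z0) + upper_dilation G z0 < L * Rabs (lower_dilation K z0) ->
  exists d, 0 < d /\ forall z1 z2,
    unit_disc z1 -> unit_disc z2 -> Cmod (z1 - z0)%C < d -> Cmod (z2 - z0)%C < d ->
    Cmod (RtoC (Cmod z1 ^ n) * G z1 - RtoC (Cmod z2 ^ n) * G z2)%C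
    <= L * Cmod (K z1 - K z2)%C.
Proof.
  intros HG HK Hz HL.
  set (lam := Rabs (lower_dilation K z0)) in *.
  set (Lam := upper_dilation G z0) in *.
  assert (Hn := pos_INR n). assert (HG0 := Cmod_ge_0 (G z0)).
  assert (HLam : 0 <= Lam).
  { unfold Lam, upper_dilation.
    assert (A1 := Cmod_ge_0 (wirtinger G z0)). assert (A2 := Cmod_ge_0 (wirtinger_bar G z0)). lra. }
  assert (Hlam : 0 <= lam) by apply Rabs_pos.
  assert (HnG : 0 <= INR n * Cmod (G z0)) by now apply Rmult_le_pos.
  assert (HL0 : 0 < L).
  { apply Rnot_le_lt. intros HL0. assert (0 <= - L * lam) by (apply Rmult_le_pos; lra). lra. }
  (* Chosen so that [(Lam + eps) + n (|G z0| + eps) = L (lam - eps)], with [n] the exponent: the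
     left side will bound the increments of the product, the right side comes from those of [K]. *)
  set (eps := (L * lam - (INR n * Cmod (G z0) + Lam)) / (1 + INR n + L)).
  assert (Heps : 0 < eps) by (apply Rdiv_lt_0_compat; lra).
  assert (Eeps : (1 + INR n + L) * eps = L * lam - (INR n * Cmod (G z0) + Lam))
    by (unfold eps; field; lra).
  destruct (C1_strictly_differentiable _ G z0 eps unit_disc_open HG Hz Heps) as (d1 & P1 & H1).
  destruct (C1_strictly_differentiable _ K z0 eps unit_disc_open HK Hz Heps) as (d2 & P2 & H2).
  assert (HGl : forall z1 z2, Cmod (z1 - z0)%C < d1 -> Cmod (z2 - z0)%C < d1 ->
            Cmod (G z1 - G z2)%C <= (Lam + eps) * Cmod (z1 - z2)%C).
  { intros z1 z2 B1 B2.
    replace (G z1 - G z2)%C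
      with ((G z1 - G z2 - wirtinger_differential G z0 (z1 - z2))
            + wirtinger_differential G z0 (z1 - z2))%C by ring.
    eapply Rle_trans; [apply Cmod_triangle|].
    specialize (H1 z1 z2 B1 B2).
    assert (W := wirtinger_differential_upper G z0 (z1 - z2)%C). fold Lam in W. lra. }
  assert (HKl : forall z1 z2, Cmod (z1 - z0)%C < d2 -> Cmod (z2 - z0)%C < d2 ->
            (lam - eps) * Cmod (z1 - z2)%C <= Cmod (K z1 - K z2)%C).
  { intros z1 z2 B1 B2.
    specialize (H2 z1 z2 B1 B2).
    assert (W := wirtinger_differential_lower K z0 (z1 - z2)%C). fold lam in W.
    assert (T := Cmod_sub_triangle (wirtinger_differential K z0 (z1 - z2)) (K z1 - K z2) 0).
    replace (wirtinger_differential K z0 (z1 - z2) - 0)%C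
      with (wirtinger_differential K z0 (z1 - z2)) in T by ring.
    replace (K z1 - K z2 - 0)%C with (K z1 - K z2)%C in T by ring.
    rewrite (Cmod_sub_sym (wirtinger_differential K z0 (z1 - z2))) in T. lra. }
  (* Within this radius the Lipschitz bound on [G] changes its value by at most [eps]. *)
  set (d3 := eps / (Lam + eps)).
  assert (P3 : 0 < d3) by (apply Rdiv_lt_0_compat; lra).
  exists (Rmin d3 (Rmin d1 d2)).
  split; [repeat apply Rmin_glb_lt; assumption|].
  intros z1 z2 D1 D2 B1 B2.
  assert (M1 := Rmin_l d3 (Rmin d1 d2)). assert (M2 := Rmin_r d3 (Rmin d1 d2)).
  assert (M3 := Rmin_l d1 d2). assert (M4 := Rmin_r d1 d2).
  specialize (HKl z1 z2 ltac:(lra) ltac:(lra)).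
  assert (HG2 : Cmod (G z2) <= Cmod (G z0) + eps).
  { assert (Z0 : Cmod (z0 - z0)%C < d1).
    { replace (z0 - z0)%C with (RtoC 0) by ring. now rewrite Cmod_0. }
    assert (B := HGl z2 z0 ltac:(lra) Z0).
    assert ((Lam + eps) * Cmod (z2 - z0)%C <= (Lam + eps) * d3)
      by (apply Rmult_le_compat_l; lra).
    assert ((Lam + eps) * d3 = eps) by (unfold d3; field; lra).
    assert (T := Cmod_triangle (G z2 - G z0) (G z0)).
    replace (G z2 - G z0 + G z0)%C with (G z2) in T by ring. lra. }
  specialize (HGl z1 z2 ltac:(lra) ltac:(lra)).
  unfold unit_disc in D1, D2.
  assert (C1 := Cmod_ge_0 z1). assert (C2 := Cmod_ge_0 z2).
  assert (V := Cmod_ge_0 (z1 - z2)%C).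
  assert (HP := pow_unit_lipschitz n (Cmod z1) (Cmod z2) ltac:(lra) ltac:(lra)).
  assert (HR := Cmod_reverse_triangle z1 z2).
  assert (HP' : Rabs (Cmod z1 ^ n - Cmod z2 ^ n) <= INR n * Cmod (z1 - z2)%C).
  { eapply Rle_trans; [exact HP|]. apply Rmult_le_compat_l; lra. }
  assert (Hp1 : 0 <= Cmod z1 ^ n <= 1).
  { split; [apply pow_le; lra|]. rewrite <- (pow1 n). apply pow_incr; lra. }
  replace (RtoC (Cmod z1 ^ n) * G z1 - RtoC (Cmod z2 ^ n) * G z2)%C
    with (RtoC (Cmod z1 ^ n) * (G z1 - G z2) + RtoC (Cmod z1 ^ n - Cmod z2 ^ n) * G z2)%C
    by (rewrite RtoC_minus; ring).
  eapply Rle_trans; [apply Cmod_triangle|]. rewrite !Cmod_mult, !Cmod_R.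
  rewrite (Rabs_pos_eq (Cmod z1 ^ n)) by lra.
  assert (Cmod z1 ^ n * Cmod (G z1 - G z2)%C <= 1 * ((Lam + eps) * Cmod (z1 - z2)%C))
    by (apply Rmult_le_compat; auto using Cmod_ge_0; lra).
  assert (Rabs (Cmod z1 ^ n - Cmod z2 ^ n) * Cmod (G z2)
          <= (INR n * Cmod (z1 - z2)%C) * (Cmod (G z0) + eps))
    by (apply Rmult_le_compat; auto using Cmod_ge_0, Rabs_pos).
  assert (L * ((lam - eps) * Cmod (z1 - z2)%C) <= L * Cmod (K z1 - K z2)%C)
    by (apply Rmult_le_compat_l; lra).
  assert (((1 + INR n + L) * eps) * Cmod (z1 - z2)%C
          = (L * lam - (INR n * Cmod (G z0) + Lam)) * Cmod (z1 - z2)%C) by now rewrite Eeps.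
  lra.
Qed.

(** * Inscribed polygons and chaining of local bounds *)

(* [polygon_sum gamma a b s]: [s] is the length of a polygon inscribed in [gamma]
   between parameters [a] and [b]; unlike the indexed sums of [path_length],
   these concatenate easily. *)
Inductive polygon_sum (gamma : R -> C) : R -> R -> R -> Prop :=
| polygon_edge a b :
    a <= b -> polygon_sum gamma a b (Cmod (gamma b - gamma a)%C)
| polygon_cons a b c s :
    a <= b -> polygon_sum gamma b c s ->
    polygon_sum gamma a c (Cmod (gamma b - gamma a)%C + s).

Lemma polygon_sum_app (gamma : R -> C) (a b c s s' : R) :
  polygon_sum gamma a b s -> polygon_sum gamma b c s' -> polygon_sum gamma a c (s + s').
Proof.
  induction 1 as [a b Hab | a x b s Hax _ IH]; intros H'.
  - now apply polygon_cons.
  - rewrite Rplus_assoc. apply polygon_cons; auto.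
Qed.

Lemma polygon_sum_ge_chord (gamma : R -> C) (a b s : R) :
  polygon_sum gamma a b s -> Cmod (gamma b - gamma a)%C <= s.
Proof.
  induction 1 as [a b Hab | a x b s Hax _ IH]; [lra|].
  assert (T := Cmod_sub_triangle (gamma b) (gamma x) (gamma a)). lra.
Qed.

Lemma polygon_sum_partition (gamma : R -> C) (a b s : R) :
  polygon_sum gamma a b s ->
  exists (n : nat) (t : nat -> R),
    t 0%nat = a /\ t (S n) = b /\
    (forall i : nat, (i <= n)%nat -> t i <= t (S i)) /\
    s = sum_f_R0 (fun i : nat => Cmod (gamma (t (S i)) - gamma (t i))%C) n.
Proof.
  induction 1 as [a b Hab | a x b s Hax _ IH].
  - exists 0%nat, (fun i => match i with 0%nat => a | _ => b end).
    repeat split. intros i Hi. replace i with 0%nat by lia. exact Hab.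
  - destruct IH as (n & t & E0 & E1 & Hmon & ->).
    exists (S n), (fun i => match i with 0%nat => a | S j => t j end).
    repeat split; auto.
    + intros [|i] Hi; [now rewrite E0 | apply Hmon; lia].
    + rewrite (decomp_sum _ (S n)) by lia. simpl. now rewrite E0.
Qed.

Lemma polygon_sum_le_length (gamma : R -> C) (s : R) :
  polygon_sum gamma 0 1 s -> Rbar_le s (path_length gamma).
Proof.
  intros H. apply (proj1 (Lub_Rbar_correct _)). now apply polygon_sum_partition.
Qed.

(** By compactness finitely many short chords cover the parameter interval, each obeying one local
    bound; the triangle inequality adds them up. Only finitely many constants occur, so their
    maximum stays strictly below [c] even though no uniform bound is assumed. *)
Lemma small_chords_polygon (gamma H : R -> C) (c : R) :
  (forall t, unit_interval t -> exists L d, 0 <= L < c /\ 0 < d /\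
     forall s s', unit_interval s -> unit_interval s' ->
       Rabs (s - t) < d -> Rabs (s' - t) < d ->
       Cmod (H s - H s')%C <= L * Cmod (gamma s - gamma s')%C) ->
  forall a b, 0 <= a -> a <= b -> b <= 1 ->
  exists L s, 0 <= L < c /\ polygon_sum gamma a b s /\ Cmod (H b - H a)%C <= L * s.
Proof.
  intros Hloc.
  assert (Hex : forall t, exists d : posreal, unit_interval t -> exists L, 0 <= L < c /\
     forall s s', unit_interval s -> unit_interval s' ->
       Rabs (s - t) < d -> Rabs (s' - t) < d ->
       Cmod (H s - H s')%C <= L * Cmod (gamma s - gamma s')%C).
  { intros t. destruct (classic (unit_interval t)) as [Ht|Ht].
    - destruct (Hloc t Ht) as (L & d & HL & Hd & HH).
      exists (mkposreal d Hd). intros _. now exists L.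
    (* A dummy radius for parameters outside the unit interval. *)
    - exists (mkposreal 1 Rlt_0_1). contradiction. }
  destruct (functional_choice _ Hex) as [del Hdel].
  (* Halved radii as in the Lebesgue number argument: if [a] lies within half the radius of [t], a
     further move of [d / 2] stays within the full radius. *)
  destruct (compactness_value_1d 0 1 (fun t => pos_div_2 (del t))) as [d Hd].
  assert (Hd0 := cond_pos d).
  assert (Hshort : forall a b, 0 <= a -> a <= b -> b <= 1 -> b <= a + d / 2 ->
            exists L, 0 <= L < c /\ Cmod (H b - H a)%C <= L * Cmod (gamma b - gamma a)%C).
  { intros a b Ha Hab Hb Hs.
    destruct (NNPP _ (Hd a ltac:(lra))) as (t & Ht & Hat & Hdt). simpl in Hat, Hdt.
    destruct (Hdel t Ht) as (L & HL & HH). exists L. split; [exact HL|].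
    apply Rabs_def2 in Hat.
    apply HH; [split; lra | split; lra | apply Rabs_def1; lra | apply Rabs_def1; lra]. }
  assert (Hind : forall n a b, 0 <= a -> a <= b -> b <= 1 -> b <= a + (INR n + 1) * (d / 2) ->
            exists L s, 0 <= L < c /\ polygon_sum gamma a b s /\ Cmod (H b - H a)%C <= L * s).
  { induction n as [|n IHn]; intros a b Ha Hab Hb Hs.
    - simpl in Hs. destruct (Hshort a b) as (L & HL & HH); try lra.
      exists L, (Cmod (gamma b - gamma a)%C). repeat split; try lra. now constructor.
    - rewrite S_INR in Hs.
      (* One step of length [d / 2], cut off at [b] when the interval ends earlier. *)
      set (x := Rmin b (a + d / 2)).
      assert (Hx : a <= x /\ x <= b /\ x <= a + d / 2 /\ b <= x + (INR n + 1) * (d / 2)).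
      { assert (0 <= (INR n + 1) * (d / 2)) by (apply Rmult_le_pos; [pose proof (pos_INR n)|]; lra).
        unfold x, Rmin. destruct (Rle_dec b (a + d / 2)); lra. }
      destruct (Hshort a x) as (L1 & HL1 & HH1); try lra.
      destruct (IHn x b) as (L2 & s & HL2 & Hp & HH2); try lra.
      exists (Rmax L1 L2), (Cmod (gamma x - gamma a)%C + s).
      assert (M1 := Rmax_l L1 L2). assert (M2 := Rmax_r L1 L2).
      split; [split; [lra | now apply Rmax_lub_lt]|].
      split; [apply polygon_cons; [lra | exact Hp]|].
      assert (T := Cmod_sub_triangle (H b) (H x) (H a)).
      assert (Hs0 := Rle_trans _ _ _ (Cmod_ge_0 _) (polygon_sum_ge_chord _ _ _ _ Hp)).
      assert (L1 * Cmod (gamma x - gamma a)%C <= Rmax L1 L2 * Cmod (gamma x - gamma a)%C)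
        by (apply Rmult_le_compat_r; [apply Cmod_ge_0 | exact M1]).
      assert (L2 * s <= Rmax L1 L2 * s) by now apply Rmult_le_compat_r.
      lra. }
  intros a b Ha Hab Hb.
  destruct (INR_unbounded (2 / d)) as [n Hn].
  apply (Hind n); auto.
  assert (2 / d * (d / 2) = 1) by (field; lra).
  assert (2 / d * (d / 2) <= INR n * (d / 2)) by (apply Rmult_le_compat_r; lra).
  lra.
Qed.

(** * Perturbations of the identity on a linearly connected domain *)

(** The constant [L] may depend on the point, so that a pointwise strict inequality, without a
    uniform gap, already gives this property. *)
Definition locally_contracting_on (Omega : C -> Prop) (h : C -> C) (c : R) : Prop :=
  forall w0, Omega w0 -> exists L r, 0 <= L < c /\ 0 < r /\
    forall w w', Omega w -> Omega w' -> Cmod (w - w0)%C < r -> Cmod (w' - w0)%C < r ->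
      Cmod (h w - h w')%C <= L * Cmod (w - w')%C.

Definition shift (h : C -> C) (w : C) : C := (w + h w)%C.

Lemma continuous_C_intro (F : C -> C) (z : C) :
  (forall eps, 0 < eps -> exists d, 0 < d /\
     forall w, Cmod (w - z)%C < d -> Cmod (F w - F z)%C < eps) ->
  continuous F z.
Proof.
  intros H P HP. apply locally_C_iff in HP. destruct HP as (eps & Heps & HP).
  destruct (H eps Heps) as (d & Hd & HF).
  apply (proj2 (locally_C_iff z (fun w => P (F w)))). exists d. auto.
Qed.

Lemma locally_contracting_continuous (Omega : C -> Prop) (h : C -> C) (c : R) (w0 : C) :
  open Omega -> locally_contracting_on Omega h c -> Omega w0 -> continuous (shift h) w0.
Proof.
  intros HO Hh Hw. destruct (Hh w0 Hw) as (L & r & HL & Hr & HLr).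
  destruct (proj1 (locally_C_iff _ _) (HO w0 Hw)) as (r' & Hr' & HOr).
  apply continuous_C_intro. intros eps Heps.
  set (d := eps / (1 + L)).
  assert (Hd : 0 < d) by (apply Rdiv_lt_0_compat; lra).
  assert (Ed : (1 + L) * d = eps) by (unfold d; field; lra).
  exists (Rmin d (Rmin r r')). split; [repeat apply Rmin_glb_lt; auto|].
  intros w B.
  assert (M1 := Rmin_l d (Rmin r r')). assert (M2 := Rmin_r d (Rmin r r')).
  assert (M3 := Rmin_l r r'). assert (M4 := Rmin_r r r').
  assert (Z : Cmod (w0 - w0)%C < r).
  { replace (w0 - w0)%C with (RtoC 0) by ring. now rewrite Cmod_0. }
  assert (H := HLr w w0 (HOr w ltac:(lra)) Hw ltac:(lra) Z).
  unfold shift. replace (w + h w - (w0 + h w0))%C with ((w - w0) + (h w - h w0))%C by ring.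
  eapply Rle_lt_trans; [apply Cmod_triangle|].
  assert ((1 + L) * Cmod (w - w0)%C < (1 + L) * d) by (apply Rmult_lt_compat_l; lra).
  lra.
Qed.

Lemma locally_contracting_along_path (Omega : C -> Prop) (h : C -> C) (c : R)
    (gamma : R -> C) (w1 w2 : C) :
  locally_contracting_on Omega h c -> path_in Omega gamma w1 w2 ->
  forall a b, 0 <= a -> a <= b -> b <= 1 ->
  exists L s, 0 <= L < c /\ polygon_sum gamma a b s /\
    Cmod (h (gamma b) - h (gamma a))%C <= L * s.
Proof.
  intros Hh (Hc & _ & _ & Hin).
  apply (small_chords_polygon gamma (fun t => h (gamma t))).
  intros t Ht. destruct (Hh _ (Hin t Ht)) as (L & r & HL & Hr & HLr).
  assert (Hloc : locally (gamma t) (fun w => Cmod (w - gamma t)%C < r)).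
  { apply locally_C_iff. now exists r. }
  destruct (Hc t Ht _ Hloc) as [d Hd].
  exists L, d. split; [exact HL|]. split; [apply cond_pos|].
  intros s s' Hs Hs' B B'. apply HLr; auto.
Qed.

(** Chain the local bounds along a path of length at most [M |w1 - w2|]; the polygon so obtained is
    inscribed, hence no longer than the path. *)
Lemma linearly_connected_displacement (Omega : C -> Prop) (h : C -> C) (M c : R) (w1 w2 : C) :
  linearly_connected_with Omega M -> locally_contracting_on Omega h c ->
  Omega w1 -> Omega w2 ->
  exists L, 0 <= L < c /\ Cmod (h w2 - h w1)%C <= L * (M * Cmod (w1 - w2)%C).
Proof.
  intros [_ HM] Hh H1 H2. destruct (HM w1 w2 H1 H2) as (gamma & Hpath & Hlen).
  destruct (locally_contracting_along_path _ _ _ _ _ _ Hh Hpath 0 1) as (L & s & HL & Hp & Hd); try lra.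
  destruct Hpath as (_ & <- & <- & _).
  exists L. split; [exact HL|]. eapply Rle_trans; [exact Hd|].
  apply Rmult_le_compat_l; [lra|].
  exact (Rbar_le_trans s _ _ (polygon_sum_le_length _ _ Hp) Hlen).
Qed.

(** A path is at least as long as its chord, and openness supplies two distinct points to compare.
    This makes division by [M] legitimate and forces [1 / M <= 1]. *)
Lemma linear_connectivity_constant_ge_1 (Omega : C -> Prop) (M : R) :
  linearly_connected_with Omega M -> 1 <= M.
Proof.
  intros [[[w Hw] [HO _]] HM].
  destruct (proj1 (locally_C_iff _ _) (HO w Hw)) as (r & Hr & HOr).
  set (w' := (w + RtoC (r / 2))%C).
  assert (E : Cmod (w' - w)%C = r / 2).
  { unfold w'. replace (w + RtoC (r / 2) - w)%C with (RtoC (r / 2)) by ring.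
    rewrite Cmod_R. apply Rabs_pos_eq. lra. }
  destruct (HM w' w) as (gamma & (_ & E0 & E1 & _) & Hlen); [apply HOr; lra | exact Hw|].
  assert (B := Rbar_le_trans _ _ _
                 (polygon_sum_le_length gamma _ (polygon_edge gamma 0 1 Rle_0_1)) Hlen).
  rewrite E0, E1 in B. simpl in B. rewrite Cmod_sub_sym, E in B.
  apply (Rmult_le_reg_r (r / 2)); lra.
Qed.

(** If the values agree, the displacement of [h] is exactly [w1 - w2], yet its modulus is at most
    [L M |w1 - w2|] with [L M < 1]. *)
Lemma shift_injective (Omega : C -> Prop) (h : C -> C) (M : R) (w1 w2 : C) :
  linearly_connected_with Omega M -> locally_contracting_on Omega h (1 / M) ->
  Omega w1 -> Omega w2 -> shift h w1 = shift h w2 -> w1 = w2.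
Proof.
  intros HM Hh H1 H2 E.
  assert (HM1 := linear_connectivity_constant_ge_1 _ _ HM).
  destruct (linearly_connected_displacement _ _ _ _ w1 w2 HM Hh H1 H2) as (L & HL & B).
  unfold shift in E.
  replace (h w2 - h w1)%C with (w1 - w2)%C in B.
  2: { replace (h w2) with ((w2 + h w2) - w2)%C by ring. rewrite <- E. ring. }
  assert (HLM : L * M < 1).
  { replace 1 with (1 / M * M) by (field; lra). apply Rmult_lt_compat_r; lra. }
  assert (V := Cmod_ge_0 (w1 - w2)%C).
  assert (Z : Cmod (w1 - w2)%C = 0).
  { apply Rle_antisym; [|exact V]. apply Rnot_lt_le. intros P.
    assert ((L * M) * Cmod (w1 - w2)%C < 1 * Cmod (w1 - w2)%C) by now apply Rmult_lt_compat_r.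
    lra. }
  apply Cmod_eq_0 in Z. replace w1 with ((w1 - w2) + w2)%C by ring. rewrite Z. ring.
Qed.

(** Near each point [shift h] is the identity up to a Lipschitz error [L < 1], so the iteration
    applies with the identity as approximate differential. *)
Lemma shift_image_open (Omega : C -> Prop) (h : C -> C) (c : R) :
  open Omega -> c <= 1 -> locally_contracting_on Omega h c ->
  open (image (shift h) Omega).
Proof.
  intros HO Hc Hh w' (w & Hw & <-).
  destruct (Hh w Hw) as (L & r & HL & Hr & HLr).
  destruct (proj1 (locally_C_iff _ _) (HO w Hw)) as (r' & Hr' & HOr).
  set (rho := Rmin r r').
  assert (Hrho : 0 < rho) by now apply Rmin_glb_lt.
  assert (M3 := Rmin_l r r'). assert (M4 := Rmin_r r r'). fold rho in M3, M4.
  apply locally_C_iff. exists ((1 - L) * rho).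
  split; [apply Rmult_lt_0_compat; lra|]. intros y Hy.
  destruct (approximately_linear_open (shift h) (fun v => v) w rho 1 L 1) with (w := y)
    as (u & Hu & E); auto.
  - lra.
  - intros v. now exists v.
  - intros v. lra.
  - intros u1 u2 B1 B2. unfold shift.
    replace (u1 + h u1 - (u2 + h u2) - (u1 - u2))%C with (h u1 - h u2)%C by ring.
    apply HLr; try apply HOr; lra.
  - exists u. split; [apply HOr; lra | exact E].
Qed.

Lemma continuous_image_connected (Omega : C -> Prop) (F : C -> C) :
  open Omega -> connected_set Omega -> (forall w, Omega w -> continuous F w) ->
  connected_set (image F Omega).
Proof.
  intros HO Hconn HF U V HU HV Hcov (y & (u & Hu & <-) & HyU) (y' & (v & Hv & <-) & HyV).
  (* Continuity is known only on [Omega], so preimages are cut down to [Omega]; they are open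
     because [Omega] is. *)
  assert (Hpre : forall W : C -> Prop, open W -> open (fun w => Omega w /\ W (F w))).
  { intros W HW w [Hw HFw]. apply filter_and; [now apply HO|].
    exact (HF w Hw W (HW _ HFw)). }
  destruct (Hconn _ _ (Hpre U HU) (Hpre V HV)) as (w & Hw & [_ HwU] & [_ HwV]).
  - intros w Hw. destruct (Hcov (F w)); [now exists w | left | right]; auto.
  - now exists u.
  - now exists v.
  - exists (F w). repeat split; auto. now exists w.
Qed.

(** The image under [shift h] of a short path in [Omega] serves as the new path: lengths grow by a
    factor at most [1 + c], while distances shrink by a factor no less than [1 - c M]. *)
Lemma shift_linearly_connected (Omega : C -> Prop) (h : C -> C) (M c : R) :
  linearly_connected_with Omega M -> locally_contracting_on Omega h c ->
  c < 1 / M -> linearly_connected (image (shift h) Omega).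
Proof.
  intros HM Hh Hc.
  assert (HM1 := linear_connectivity_constant_ge_1 _ _ HM).
  assert (HM' := HM). destruct HM' as [([w0 Hw0] & HO & Hconn) HMp].
  assert (HcM : c * M < 1).
  { replace 1 with (1 / M * M) by (field; lra). apply Rmult_lt_compat_r; lra. }
  assert (Hc0 : 0 < c) by (destruct (Hh w0 Hw0) as (L & _ & HL & _); lra).
  assert (Hc1 : c <= 1).
  { assert (c * 1 <= c * M) by (apply Rmult_le_compat_l; lra). lra. }
  assert (Hcont : forall w, Omega w -> continuous (shift h) w)
    by (intros w; now apply (locally_contracting_continuous Omega h c)).
  exists ((1 + c) * M / (1 - c * M)). split.
  { split; [|split].
    - exists (shift h w0). now exists w0.
    - now apply (shift_image_open Omega h c).
    - now apply continuous_image_connected. }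
  intros y1 y2 (w1 & Hw1 & <-) (w2 & Hw2 & <-).
  destruct (HMp w1 w2 Hw1 Hw2) as (gamma & Hpath & Hlen).
  exists (fun t => shift h (gamma t)). split.
  - destruct Hpath as (Hg & E0 & E1 & Hin). split; [|split; [|split]].
    + intros t Ht. eapply filterlim_comp; [now apply Hg | now apply Hcont, Hin].
    + now rewrite E0.
    + now rewrite E1.
    + intros t Ht. exists (gamma t). auto.
  - assert (Hdisp : (1 - c * M) * Cmod (w1 - w2)%C <= Cmod (shift h w1 - shift h w2)%C).
    { destruct (linearly_connected_displacement _ _ _ _ w1 w2 HM Hh Hw1 Hw2) as (L & HL & B).
      assert (V := Cmod_ge_0 (w1 - w2)%C).
      assert (L * (M * Cmod (w1 - w2)%C) <= c * (M * Cmod (w1 - w2)%C))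
        by (apply Rmult_le_compat_r; [apply Rmult_le_pos|]; lra).
      assert (T := Cmod_triangle (shift h w1 - shift h w2) (h w2 - h w1)).
      unfold shift in T at 1 2.
      replace (w1 + h w1 - (w2 + h w2) + (h w2 - h w1))%C with (w1 - w2)%C in T by ring.
      lra. }
    apply (proj2 (Lub_Rbar_correct _)). intros s (n & t & T0 & T1 & Hmon & ->).
    (* An edge inscribed in the image path may join far apart points, where no chord bound for [h]
       is available. Each edge is therefore compared with a finer polygon inscribed in [gamma] over
       the same parameter interval. *)
    assert (Hsum : forall m, (m <= n)%nat ->
              exists S', polygon_sum gamma (t 0%nat) (t (S m)) S' /\
                sum_f_R0 (fun i => Cmod (shift h (gamma (t (S i))) - shift h (gamma (t i)))%C) m
                <= (1 + c) * S').
    { assert (Hle : forall i j, (i <= j)%nat -> (j <= S n)%nat -> t i <= t j).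
      { intros i j Hij. induction Hij as [|j Hij IH]; intros Hj; [lra|].
        apply Rle_trans with (t j); [apply IH | apply Hmon]; lia. }
      assert (Hstep : forall i, (i <= n)%nat -> exists s,
                polygon_sum gamma (t i) (t (S i)) s /\
                Cmod (shift h (gamma (t (S i))) - shift h (gamma (t i)))%C <= (1 + c) * s).
      { intros i Hi.
        assert (B0 := Hle 0%nat i ltac:(lia) ltac:(lia)).
        assert (B1 := Hle (S i) (S n) ltac:(lia) ltac:(lia)).
        destruct (locally_contracting_along_path _ _ _ _ _ _ Hh Hpath (t i) (t (S i)))
          as (L & s & HL & Hp & Hd); try lra; [now apply Hmon|].
        exists s. split; [exact Hp|].
        assert (Hch := polygon_sum_ge_chord _ _ _ _ Hp).
        assert (V := Cmod_ge_0 (gamma (t (S i)) - gamma (t i))%C).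
        assert (L * s <= c * s) by (apply Rmult_le_compat_r; lra).
        assert (T := Cmod_triangle (gamma (t (S i)) - gamma (t i))
                       (h (gamma (t (S i))) - h (gamma (t i)))).
        unfold shift.
        replace (gamma (t (S i)) + h (gamma (t (S i))) - (gamma (t i) + h (gamma (t i))))%C
          with ((gamma (t (S i)) - gamma (t i)) + (h (gamma (t (S i))) - h (gamma (t i))))%C by ring.
        lra. }
      intros m Hm. induction m as [|m IHm].
      - exact (Hstep 0%nat Hm).
      - destruct IHm as (s1 & P1 & Q1); [lia|].
        destruct (Hstep (S m) Hm) as (s2 & P2 & Q2).
        exists (s1 + s2). split; [eapply polygon_sum_app; eauto|]. simpl. simpl in Q2. lra. }
    destruct (Hsum n (le_n _)) as (S' & HS & HB).
    rewrite T0, T1 in HS.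
    assert (HSM := Rbar_le_trans _ _ _ (polygon_sum_le_length _ _ HS) Hlen). simpl in HSM.
    change (sum_f_R0 (fun i => Cmod (shift h (gamma (t (S i))) - shift h (gamma (t i)))%C) n
            <= (1 + c) * M / (1 - c * M) * Cmod (shift h w1 - shift h w2)%C).
    eapply Rle_trans; [exact HB|].
    apply Rle_trans with ((1 + c) * (M * Cmod (w1 - w2)%C)); [apply Rmult_le_compat_l; lra|].
    replace ((1 + c) * (M * Cmod (w1 - w2)%C))
      with ((1 + c) * M / (1 - c * M) * ((1 - c * M) * Cmod (w1 - w2)%C)) by (field; lra).
    apply Rmult_le_compat_l; [|exact Hdisp].
    apply Rdiv_le_0_compat; [apply Rmult_le_pos|]; lra.
Qed.

(** * Passage from the disc to the image of [K], and conclusion *)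

(** Closeness in the image must yield closeness in the disc, that is, continuity of [kinv]: local
    openness produces a nearby preimage, and injectivity identifies it with the value of [kinv]. *)
Lemma locally_contracting_transfer (K g kinv : C -> C) (c : R) :
  C1_on unit_disc K -> univalent_on unit_disc K ->
  (forall z, unit_disc z -> lower_dilation K z <> 0) ->
  (forall w, image K unit_disc w -> unit_disc (kinv w) /\ K (kinv w) = w) ->
  (forall z0, unit_disc z0 -> exists L d, 0 <= L < c /\ 0 < d /\
     forall z1 z2, unit_disc z1 -> unit_disc z2 ->
       Cmod (z1 - z0)%C < d -> Cmod (z2 - z0)%C < d ->
       Cmod (g z1 - g z2)%C <= L * Cmod (K z1 - K z2)%C) ->
  locally_contracting_on (image K unit_disc) (fun w => g (kinv w)) c.
Proof.
  intros HK Hinj Hlam Hkinv Hg w0 (z0 & Hz0 & <-).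
  destruct (Hg z0 Hz0) as (L & d & HL & Hd & H).
  (* The second bound keeps the preimage found by openness inside the disc, where injectivity
     holds. *)
  set (d' := Rmin d (1 - Cmod z0)).
  assert (Hz0' := Hz0). unfold unit_disc in Hz0'.
  assert (Hd' : 0 < d') by (apply Rmin_glb_lt; lra).
  assert (M1 := Rmin_l d (1 - Cmod z0)). assert (M2 := Rmin_r d (1 - Cmod z0)).
  fold d' in M1, M2.
  destruct (C1_locally_open unit_disc K z0 d' unit_disc_open HK Hz0 (Hlam _ Hz0) Hd')
    as (s & Hs & Hsurj).
  assert (Hnear : forall w, image K unit_disc w -> Cmod (w - K z0)%C < s ->
            Cmod (kinv w - z0)%C < d).
  { intros w Hw B. destruct (Hsurj w B) as (u & Hu & E).
    destruct (Hkinv w Hw) as [Hkd HkE].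
    assert (Du : unit_disc u).
    { unfold unit_disc. assert (T := Cmod_triangle (u - z0) z0).
      replace (u - z0 + z0)%C with u in T by ring. lra. }
    rewrite (Hinj (kinv w) u Hkd Du); [lra | now rewrite HkE]. }
  exists L, s. split; [exact HL|]. split; [exact Hs|].
  intros w w' Hw Hw' B B'.
  destruct (Hkinv w Hw) as [D E]. destruct (Hkinv w' Hw') as [D' E'].
  rewrite <- E at 2. rewrite <- E' at 2. apply H; auto.
Qed.

Theorem theorem1 :
  forall (p : nat) (G K f : C -> C) (M : R),
    (1 <= p)%nat ->
    C1_on unit_disc G ->
    harmonic_on unit_disc K ->
    (forall z : C, unit_disc z ->
       f z = (RtoC (Cmod z ^ (2 * (p - 1))) * G z + K z)%C) ->
    univalent_on unit_disc K ->
    linearly_connected_with (image K unit_disc) M ->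
    (forall z : C, unit_disc z -> lower_dilation K z <> 0) ->
    ((forall z : C, unit_disc z ->
        (2 * (INR p - 1) * Cmod (G z) + upper_dilation G z)
          / Rabs (lower_dilation K z) < 1 / M) ->
     univalent_on unit_disc f)
    /\
    (forall c : R,
      (forall z : C, unit_disc z ->
         (2 * (INR p - 1) * Cmod (G z) + upper_dilation G z)
           / Rabs (lower_dilation K z) <= c) ->
      c < 1 / M ->
      linearly_connected (image f unit_disc)).
Proof.
  intros p G K f M Hp HG [[[HKr _] [HKi _]] _] Hf Hinj HM Hlam.
  assert (HK : C1_on unit_disc K) by now split.
  clear HKr HKi.
  set (g := fun z : C => (RtoC (Cmod z ^ (2 * (p - 1))) * G z)%C).
  assert (Hkinv : exists kinv : C -> C, forall w,
            image K unit_disc w -> unit_disc (kinv w) /\ K (kinv w) = w).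
  { apply (functional_choice (fun w z => image K unit_disc w -> unit_disc z /\ K z = w)).
    intros w. destruct (classic (image K unit_disc w)) as [(z & Hz)|Hw].
    - now exists z.
    (* Off the image any value will do. *)
    - now exists w. }
  destruct Hkinv as [kinv Hkinv].
  set (h := fun w => g (kinv w)).
  assert (Hfh : forall z, unit_disc z -> f z = shift h (K z)).
  { intros z Hz. unfold shift, h.
    destruct (Hkinv (K z)) as [D E]; [now exists z|].
    rewrite (Hinj (kinv (K z)) z D Hz E), (Hf z Hz). unfold g. ring. }
  set (Q := fun z => (2 * (INR p - 1) * Cmod (G z) + upper_dilation G z)
                       / Rabs (lower_dilation K z)).
  assert (HQ : forall c, (forall z, unit_disc z -> exists L, Q z < L /\ L < c) ->
            locally_contracting_on (image K unit_disc) h c).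
  { intros c Hc. apply (locally_contracting_transfer K g kinv); auto.
    intros z0 Hz0. destruct (Hc z0 Hz0) as (L & HL1 & HL2).
    assert (Hl : 0 < Rabs (lower_dilation K z0)) by now apply Rabs_pos_lt, Hlam.
    (* The natural subtraction is truncated; [1 <= p] makes it agree with the real one. *)
    assert (Hn : 2 * (INR p - 1) = INR (2 * (p - 1)))
      by (rewrite mult_INR, minus_INR by exact Hp; simpl; ring).
    assert (HL0 : 0 <= Q z0).
    { unfold Q. rewrite Hn. apply Rdiv_le_0_compat; [|exact Hl].
      apply Rplus_le_le_0_compat.
      - apply Rmult_le_pos; [apply pos_INR | apply Cmod_ge_0].
      - apply Rplus_le_le_0_compat; apply Cmod_ge_0. }
    destruct (radial_weight_locally_lipschitz (2 * (p - 1)) G K z0 L HG HK Hz0) as (d & Hd & H).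
    { rewrite <- Hn. replace (2 * (INR p - 1) * Cmod (G z0) + upper_dilation G z0)
        with (Q z0 * Rabs (lower_dilation K z0)) by (unfold Q; field; lra).
      now apply Rmult_lt_compat_r. }
    exists L, d. split; [lra|]. auto. }
  split.
  - intros Hlt z1 z2 H1 H2 E. apply Hinj; auto.
    apply (shift_injective _ h M _ _ HM).
    + apply HQ. intros z Hz. specialize (Hlt z Hz). fold (Q z) in Hlt.
      (* A midpoint, since the local comparison needs a constant strictly above the quotient. *)
      exists ((Q z + 1 / M) / 2). lra.
    + now exists z1.
    + now exists z2.
    + now rewrite <- !Hfh.
  - intros c Hle Hc.
    replace (image f unit_disc) with (image (shift h) (image K unit_disc)).
    (* The quotient may equal [c], so the contraction bound is raised to the midpoint of [c] and
       [1 / M]; the local constant is then the midpoint of [c] and this new bound. *)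
    + apply (shift_linearly_connected _ h M ((c + 1 / M) / 2) HM); [|lra].
      apply HQ. intros z Hz. specialize (Hle z Hz). fold (Q z) in Hle.
      exists ((3 * c + 1 / M) / 4). lra.
    + apply functional_extensionality. intros w. apply propositional_extensionality. split.
      * intros (y & (z & Hz & <-) & <-). exists z. auto.
      * intros (z & Hz & <-). exists (K z). rewrite Hfh by assumption.
        split; [now exists z | reflexivity].
Qed.
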